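(* Let $T_n$ be the chain triangular cactus of length $n$. For every $n\geq 3$, $$D(T_n,x)=(x^2+2x)\,D(T_{n-1},x)+(x^2+x)\,D(T_{n-2},x),$$ with initial conditions $D(T_1,x)=x^3+3x^2+3x$ and $D(T_2,x)=x^5+5x^4+10x^3+8x^2+x$.
   Context: For a finite simple graph $G=(V,E)$, a set $S\subseteq V$ is dominating if every vertex of $V\setminus S$ is adjacent to at least one vertex of $S$. Let $d(G,i)$ be the number of dominating sets of $G$ of cardinality $i$. The domination polynomial of $G$ is $D(G,x)=\sum_{i=\gamma(G)}^{|V|} d(G,i)x^i$, where $\gamma(G)$ is the minimum cardinality of a dominating set. A triangular cactus is a connected graph in which no edge lies in more than one cycle and all of whose blocks are triangles. It is a chain triangular cactus if each triangle has at most two cut-vertices and each cut-vertex is shared by exactly two triangles; its length is the number of triangles. All chain triangular cacti of the same length $n\ge 1$ are isomorphic, and $T_n$ denotes this graph. Concretely, $T_n$ has vertices $c_0,\dots,c_n,m_1,\dots,m_n$ and edges $c_{i-1}c_i,\ c_{i-1}m_i,\ c_im_i$ for $1\le i\le n$. *)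

(* Defs.v *)
From HB Require Import structures.
From mathcomp Require Import all_boot all_order all_algebra.
Set Implicit Arguments.
Unset Strict Implicit.
Unset Printing Implicit Defensive.
Import GRing.Theory.
Local Open Scope ring_scope.

Record sgraph := SGraph {
  vertex : finType;
  adj : rel vertex;
  adj_sym : symmetric adj;
  adj_irrefl : irreflexive adj
}.

Definition dominating (G : sgraph) (S : {set vertex G}) : bool :=
  [forall v in ~: S, exists u in S, adj v u].

Definition dom_count (G : sgraph) (i : nat) : nat :=
  #|[set S : {set vertex G} | dominating S && (#|S| == i)%N]|.

(* The default [set: vertex G] of the arg min is dominating. *)
Definition dom_number (G : sgraph) : nat :=
  #|[arg min_(S < [set: vertex G] | dominating S) #|S|]|.

Definition dom_poly (G : sgraph) : {poly int} :=
  \sum_(dom_number G <= i < #|vertex G|.+1) (dom_count G i)%:R *: 'X^i.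

(* [inl i] is c_i for 0 <= i <= n and [inr j] is m_(j+1) for 0 <= j < n, so the
   triangles are {c_j, c_(j+1), m_(j+1)}. *)
Definition cactus_vertex (n : nat) : finType := ('I_n.+1 + 'I_n)%type.

Definition cactus_adj (n : nat) : rel (cactus_vertex n) := fun u v =>
  match u, v with
  | inl i, inl j => ((i.+1 == j) || (j.+1 == i))%N
  | inl i, inr j | inr j, inl i => ((i == j :> nat) || (i == j.+1 :> nat))%N
  | inr _, inr _ => false
  end.

Lemma cactus_adj_sym n : symmetric (@cactus_adj n).
Proof. by case=> [i|i] [j|j] //=; rewrite orbC. Qed.

Lemma cactus_adj_irrefl n : irreflexive (@cactus_adj n).
Proof. by case=> [i|i] //=; rewrite orbb eqn_leq ltnn. Qed.

Definition chain_cactus (n : nat) : sgraph :=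
  SGraph (@cactus_adj_sym n) (@cactus_adj_irrefl n).

(* Main.v *)
Require Import Defs.
From mathcomp Require Import all_boot all_order all_algebra.
From mathcomp Require Import ring.
Local Open Scope ring_scope.

(** A set of vertices of T_n with n >= 1 is dominating iff it meets every
    triangle: m_j sees only its own triangle, and every vertex lies in some
    triangle.  Let A_n and B_n be the generating polynomials of the sets meeting
    every triangle that contain, respectively omit, the end vertex c_0.  Gluing a
    new triangle at c_0 gives
      A_(n+1) = x (1 + x) (A_n + B_n)   and   B_(n+1) = (1 + x) A_n + x B_n.
    This transfer matrix has trace x^2 + 2x and determinant -(x^2 + x), so the
    recurrence for D(T_n, x) = A_n + B_n is Cayley-Hamilton. *)

Import GRing.Theory.
Set Implicit Arguments.
Unset Strict Implicit.
Unset Printing Implicit Defensive.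

Lemma dominating_setT (G : sgraph) : dominating [set: vertex G].
Proof. by apply/forall_inP => v; rewrite setCT inE. Qed.

Lemma dom_number_le (G : sgraph) (S : {set vertex G}) :
  dominating S -> (dom_number G <= #|S|)%N.
Proof.
by rewrite /dom_number; case: arg_minnP => [|T _ minT /minT //];
  exact: dominating_setT.
Qed.

(** No dominating set is smaller than [dom_number G], so the sum may start at 0; its terms then
    group the dominating sets by cardinality. *)
Lemma dom_polyE (G : sgraph) :
  dom_poly G = \sum_(S : {set vertex G} | dominating S) 'X^#|S|.
Proof.
have le_gamma : (dom_number G <= #|vertex G|.+1)%N.
  by apply: leqW; rewrite -cardsT; exact/dom_number_le/dominating_setT.
have -> : dom_poly G = \sum_(i < #|vertex G|.+1) (dom_count G i)%:R *: 'X^i.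
  rewrite -(big_mkord xpredT (fun i => (dom_count G i)%:R *: 'X^i)).
  rewrite (big_cat_nat _ le_gamma) //= big_nat big1 ?add0r // => i /andP[_ ltig].
  rewrite [dom_count G i](_ : _ = 0%N) ?scale0r //; apply: eq_card0 => S.
  rewrite inE; apply/negP => /andP[/dom_number_le + /eqP cardS].
  by rewrite cardS leqNgt ltig.
have card_lt (S : {set vertex G}) : (#|S| < #|vertex G|.+1)%N.
  by rewrite ltnS max_card.
rewrite (partition_big (fun S => Ordinal (card_lt S)) xpredT) //=.
apply: eq_bigr => i _.
rewrite (eq_bigr (fun=> 'X^i)); last by move=> S /andP[_ /eqP <-].
rewrite big_const iter_addr_0 scaler_nat /dom_count; congr (_ *+ _).
by apply: eq_card => S; rewrite !inE.
Qed.

Definition meets_triangles (n : nat) (S : {set cactus_vertex n}) : bool :=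
  [forall j : 'I_n, [|| inr j \in S, inl (widen_ord (leqnSn n) j) \in S
                      | inl (lift ord0 j) \in S]].

Lemma dominating_chain_cactusE (n : nat) (S : {set cactus_vertex n.+1}) :
  dominating (S : {set vertex (chain_cactus n.+1)}) = meets_triangles S.
Proof.
apply/forall_inP/forallP => [domS j | meetS v].
  have [//|/= mj_notin] := boolP (inr j \in S).
  have /existsP[[i|i] /andP[iS //= /orP[/eqP ij|/eqP ij]]] :=
    domS (inr j) (etrans (in_setC _ _) mj_notin).
    by rewrite (_ : widen_ord _ j = i) ?iS //; exact/val_inj.
  by rewrite (_ : lift ord0 j = i) ?iS ?orbT //; exact/val_inj.
rewrite inE => vS; apply/existsP.
case: v vS => [i|j] vS; last first.
  have /or3P[mS|cS|cS] := meetS j; first by rewrite mS in vS.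
    by exists (inl (widen_ord (leqnSn _) j)); rewrite cS /= eqxx.
  by exists (inl (lift ord0 j)); rewrite cS /= eqxx orbT.
(* A vertex c_(j+1) uses the triangle of index [j], which it closes. The leftover c_0 uses the first
   triangle, which exists because the length is positive; in length 0 the empty set meets every
   triangle but misses c_0. *)
case: (unliftP ord0 i) vS => [j|] -> vS.
  have /or3P[mS|cS|cS] := meetS j; last by rewrite cS in vS.
    by exists (inr j); rewrite mS /= eqxx orbT.
  by exists (inl (widen_ord (leqnSn _) j)); rewrite cS /= eqxx orbT.
have /or3P[mS|cS|cS] := meetS ord0.
- by exists (inr ord0); rewrite mS.
- by rewrite (_ : widen_ord _ _ = ord0) in cS; [rewrite cS in vS | exact/val_inj].
- by exists (inl (lift ord0 ord0)); rewrite cS.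
Qed.

(* T_(n+1) is T_n shifted by one index, with a new triangle {c_0, m_1, c_1}; the
   booleans tell whether c_0 and m_1 are taken. *)
Definition glue_triangle (n : nat) (S : {set cactus_vertex n}) (c m : bool) :
    {set cactus_vertex n.+1} :=
  [set v | match v with
           | inl i => if unlift ord0 i is Some j then inl j \in S else c
           | inr i => if unlift ord0 i is Some j then inr j \in S else m
           end].

Section GlueTriangle.
Variables (n : nat) (S : {set cactus_vertex n}) (c m : bool).

Lemma glue_c0 : (inl ord0 \in glue_triangle S c m) = c.
Proof. by rewrite inE unlift_none. Qed.

Lemma glue_m1 : (inr ord0 \in glue_triangle S c m) = m.
Proof. by rewrite inE unlift_none. Qed.

Lemma glue_cS i : (inl (lift ord0 i) \in glue_triangle S c m) = (inl i \in S).
Proof. by rewrite inE liftK. Qed.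

Lemma glue_mS i : (inr (lift ord0 i) \in glue_triangle S c m) = (inr i \in S).
Proof. by rewrite inE liftK. Qed.

Lemma card_glue_triangle : #|glue_triangle S c m| = (c + m + #|S|)%N.
Proof.
rewrite -!sum1_card big_mkcond /= !big_sumType /=.
rewrite big_ord_recl [X in (_ + X = _)%N]big_ord_recl glue_c0 glue_m1 addnACA.
congr addn.
by congr addn; rewrite [RHS]big_mkcond; apply: eq_bigr => i _;
  rewrite (glue_cS, glue_mS).
Qed.

Lemma meets_triangles_glue :
  meets_triangles (glue_triangle S c m)
  = [|| m, c | inl ord0 \in S] && meets_triangles S.
Proof.
have widen0 : widen_ord (leqnSn n.+1) ord0 = ord0 by exact/val_inj.
have widenS i : widen_ord (leqnSn n.+1) (lift ord0 i)
    = lift ord0 (widen_ord (leqnSn n) i) by exact/val_inj.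
apply/forallP/andP => [meetT | [meet0 /forallP meetS] j].
  split; first by have := meetT ord0; rewrite widen0 glue_m1 glue_c0 glue_cS.
  by apply/forallP => i; have := meetT (lift ord0 i); rewrite widenS glue_mS !glue_cS.
case: (unliftP ord0 j) => [i|] ->.
  by rewrite widenS glue_mS !glue_cS; exact: meetS.
by rewrite widen0 glue_m1 glue_c0 glue_cS.
Qed.

End GlueTriangle.

(** Gluing is a bijection: its inverse reads off membership of c_0 and m_1 and shifts the other
    indices down by one. *)
Lemma sum_glue_triangle (V : nmodType) (n : nat)
    (P : pred {set cactus_vertex n.+1}) (F : {set cactus_vertex n.+1} -> V) :
  \sum_(S | P S) F S
  = \sum_c \sum_m \sum_(S | P (glue_triangle S c m)) F (glue_triangle S c m).
Proof.
under [RHS]eq_bigr do rewrite pair_big_dep.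
rewrite pair_big_dep /=.
rewrite (reindex (fun p : bool * (bool * {set cactus_vertex n}) =>
  glue_triangle p.2.2 p.1 p.2.1)) //=.
exists (fun S : {set cactus_vertex n.+1} => (inl ord0 \in S, (inr ord0 \in S,
  [set v : cactus_vertex n | match v with
                             | inl i => inl (lift ord0 i) \in S
                             | inr i => inr (lift ord0 i) \in S
                             end]))).
  move=> [c [m S]] _ /=; rewrite glue_c0 glue_m1; do 2!congr pair.
  by apply/setP => -[i|i]; rewrite inE (glue_cS, glue_mS).
move=> S _ /=; apply/setP => -[i|i]; case: (unliftP ord0 i) => [j|] ->.
- by rewrite glue_cS inE.
- by rewrite glue_c0.
- by rewrite glue_mS inE.
- by rewrite glue_m1.
Qed.

(** A_n is the case [b = true], B_n the case [b = false]. *)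
Definition end_poly (n : nat) (b : bool) : {poly int} :=
  \sum_(S : {set cactus_vertex n} | meets_triangles S && ((inl ord0 \in S) == b))
    'X^#|S|.

Lemma sum_meets_triangles (n : nat) :
  \sum_(S : {set cactus_vertex n} | meets_triangles S) 'X^#|S|
  = end_poly n true + end_poly n false.
Proof.
rewrite (bigID (fun S : {set cactus_vertex n} => inl ord0 \in S)) /=.
by congr (_ + _); apply: eq_bigl => S; case: (_ \in S).
Qed.

Lemma end_polyS (n : nat) (b : bool) :
  end_poly n.+1 b = 'X^b * ('X * (end_poly n true + end_poly n false)
     + (end_poly n true + (if b then end_poly n false else 0))).
Proof.
rewrite {1}/end_poly sum_glue_triangle.
rewrite (bigD1 b) //= [X in _ + X]big1 ?addr0; last first.
  move=> c /negPf cNb; rewrite big1 // => m _; rewrite big1 // => S.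
  by rewrite glue_c0 cNb andbF.
(* Split on m_1. If it is taken, the new triangle is met and the rest is free, giving the factor
   ['X] times A_n + B_n. *)
rewrite big_bool /= mulrDr; congr (_ + _).
  rewrite -sum_meets_triangles mulrA !mulr_sumr; apply: eq_big => S.
    by rewrite meets_triangles_glue glue_c0 eqxx andbT.
  by rewrite card_glue_triangle -exprSr -exprD addn1.
under eq_bigr do rewrite card_glue_triangle addn0 exprD.
rewrite -mulr_sumr; congr (_ * _).
(* With m_1 omitted, taking c_0 leaves the rest free, while omitting c_0 forces the old end vertex
   and leaves only A_n. *)
case: b; [rewrite -sum_meets_triangles | rewrite addr0]; apply: eq_bigl => S;
  rewrite meets_triangles_glue glue_c0 eqxx andbT //=.
by rewrite eqb_id andbC.
Qed.

(** T_0 is the single vertex c_0 without triangles, so even the empty set counts. This seeds the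
    recursion for both initial conditions. *)
Lemma end_poly0 (b : bool) : end_poly 0 b = 'X^b.
Proof.
have meets0 (S : {set cactus_vertex 0}) : meets_triangles S by apply/forallP => -[].
have vertex0 (v : cactus_vertex 0) : v = inl ord0.
  by case: v => [i|[]//]; rewrite (ord1 i).
rewrite /end_poly (big_pred1 (if b then setT else set0)).
  by case: b; rewrite ?cards0 // cardsT card_sum !card_ord.
move=> S; rewrite meets0 /=; apply/eqP/eqP => [Sb | ->].
  by apply/setP => v; rewrite (vertex0 v) Sb; case: b Sb; rewrite inE.
by case: b; rewrite inE.
Qed.

Lemma dom_poly_chain_cactusE (n : nat) :
  dom_poly (chain_cactus n.+1) = end_poly n.+1 true + end_poly n.+1 false.
Proof.
rewrite dom_polyE -sum_meets_triangles; apply: eq_bigl => S.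
exact: dominating_chain_cactusE.
Qed.

Theorem theorem4 :
  [/\ forall n : nat, (3 <= n)%N ->
        dom_poly (chain_cactus n) =
          ('X^2 + 2 *: 'X) * dom_poly (chain_cactus (n - 1)%N)
          + ('X^2 + 'X) * dom_poly (chain_cactus (n - 2)%N),
      dom_poly (chain_cactus 1) = 'X^3 + 3 *: 'X^2 + 3 *: 'X
    & dom_poly (chain_cactus 2) =
        'X^5 + 5 *: 'X^4 + 10 *: 'X^3 + 8 *: 'X^2 + 'X].
Proof.
split=> [[|[|[|n]]] // _||].
- rewrite !subSS !subn0 !dom_poly_chain_cactusE.
  (* Naming the two instances stops the unfolding at [end_poly n.+1], so both sides become
     combinations of A_(n+1) and B_(n+1). *)
  rewrite !(end_polyS n.+2, end_polyS n.+1) /= !scaler_nat expr0 expr1.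
  by ring.
- by rewrite dom_poly_chain_cactusE !end_polyS !end_poly0 /= !scaler_nat; ring.
- by rewrite dom_poly_chain_cactusE !end_polyS !end_poly0 /= !scaler_nat; ring.
Qed.
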